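(* Let $n$ be a fixed positive integer, let $a,b\in\mathbb{C}$ with $|ab|<1$, and let $x\in\mathbb{C}$ be arbitrary. Then, for $j\in\{0,1,2,\dots,n-1\}$, the $j$-th component of the eigenvector corresponding to the eigenvalue $i^k$ ($k$ an integer) of the discrete Fourier transform (DFT) of size $n$ is $$v_j(k)=f_{(\frac{j}{n},0,n)}(a,b,x)+(-1)^k f_{(\frac{-j}{n},0,n)}(a,b,x)+\frac{1}{\sqrt{n}}\left[(-i)^k f_{(0,\frac{j}{n},1)}\left(a^{1/n^2},b^{1/n^2},x/n\right)+(-i)^{3k}f_{(0,\frac{-j}{n},1)}\left(a^{1/n^2},b^{1/n^2},x/n\right)\right].$$
   Context: The DFT of size $n$ is the $n\times n$ matrix $A$ with entries $A_{jl}=\frac{1}{\sqrt n}e^{2\pi i jl/n}$, $j,l\in\mathbb{Z}_n=\{0,1,\dots,n-1\}$; it satisfies $A^4=I$. The Ramanujan theta function with characteristics $(\alpha,\beta,c)$ is $$f_{(\alpha,\beta,c)}(a,b,x)=\sum_{m\in\mathbb{Z}}a^{\frac{(m+\alpha)(m+\alpha+1/c)}{2}}\,b^{\frac{(m+\alpha)(m+\alpha-1/c)}{2}}\,e^{2\pi i(m+\alpha)(x+\beta)}.$$ No particular branch is specified for the fractional powers of $a$ and $b$.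
   Formalization: ''Eigenvector for i^k'' is read as the equation A v(k) = i^k v(k); v(k) is not claimed to be nonzero, since it can vanish (e.g. n = 1, k = 1, where i is not an eigenvalue). Fractional powers of a and b use any fixed branch of the logarithm. *)

(* Defs.v *)
From HB Require Import structures.
From mathcomp Require Import all_boot all_order all_algebra.
From mathcomp Require Import all_classical all_reals all_analysis.
From mathcomp Require Import complex.

Set Implicit Arguments.
Unset Strict Implicit.
Unset Printing Implicit Defensive.

Import Order.TTheory GRing.Theory Num.Theory.
Import numFieldNormedType.Exports.

Local Open Scope ring_scope.
Local Open Scope complex_scope.

Definition cexp (R : realType) (z : R[i]) : R[i] :=
  let: u +i* v := z in (expR u)%:C * (cos v +i* sin v).

(* A choice of a logarithm for every nonzero complex number. No continuity
   or normalization is required, so this covers the principal branch as well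
   as every other determination of the fractional powers. *)
Definition log_branch (R : realType) (L : R[i] -> R[i]) : Prop :=
  forall z : R[i], z != 0 -> cexp (L z) = z.

(* z ^ s for the determination L of the logarithm. The base 0 follows the
   usual convention 0 ^ 0 = 1 and 0 ^ s = 0 for s > 0; it matters because
   |ab| < 1 allows a = 0 or b = 0. *)
Definition cpow (R : realType) (L : R[i] -> R[i]) (z s : R[i]) : R[i] :=
  if z == 0 then (s == 0)%:R else cexp (s * L z).

(* \sum_(m in Z) u m, as the sum of the series over m >= 0 and over m < 0;
   the regular algebra R[i]^o carries the topology of the complex modulus. *)
Definition bilateral_sum (R : realType) (u : int -> R[i]) : R[i] :=
  limn (series (fun k : nat => u k%:Z : R[i]^o)) +
  limn (series (fun k : nat => u (- k.+1%:Z) : R[i]^o)).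

(* The powers of a and b are taken with the determinations La and Lb. *)
Definition theta_term (R : realType) (La Lb : R[i] -> R[i])
    (alpha beta c a b x : R[i]) (m : int) : R[i] :=
  let t := m%:~R + alpha in
  cpow La a (t * (t + c^-1) / 2) * cpow Lb b (t * (t - c^-1) / 2) *
  cexp ((2 * pi)%:C * 'i%C * t * (x + beta)).

Definition theta (R : realType) (La Lb : R[i] -> R[i])
    (alpha beta c a b x : R[i]) : R[i] :=
  bilateral_sum (theta_term La Lb alpha beta c a b x).

Definition dft (R : realType) (n : nat) : 'M[R[i]]_n :=
  \matrix_(j, l) ((Num.sqrt n%:R)%:C^-1 *
                  cexp ((2 * pi)%:C * 'i%C * j%:R * l%:R / n%:R)).

(* a ^ (1 / n^2) is taken with the same determination La as the fractional
   powers of a in the first two theta functions, and likewise for b. *)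
Definition theta_vec (R : realType) (La Lb : R[i] -> R[i]) (n : nat)
    (a b x : R[i]) (k : int) : 'cV[R[i]]_n :=
  let a' := cpow La a (n%:R ^+ 2)^-1 in
  let b' := cpow Lb b (n%:R ^+ 2)^-1 in
  let x' := x / n%:R in
  \col_(j < n)
    (theta La Lb (j%:R / n%:R) 0 n%:R a b x
     + (-1) ^ k * theta La Lb (- j%:R / n%:R) 0 n%:R a b x
     + (Num.sqrt n%:R)%:C^-1 *
       ((- 'i%C) ^ k * theta La Lb 0 (j%:R / n%:R) 1 a' b' x'
        + (- 'i%C) ^ (3 * k) * theta La Lb 0 (- j%:R / n%:R) 1 a' b' x')).

(* Main.v *)
(* Put g(M) = a^(M(M+1)/(2n^2)) b^(M(M-1)/(2n^2)) exp(2 pi i M x / n) for an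
   integer M. Then F_j := f_(j/n,0,n)(a,b,x) is the sum of g over the residue
   class of j modulo n, and G_j := f_(0,j/n,1)(a^(1/n^2),b^(1/n^2),x/n) is the
   sum over all M of g(M) exp(2 pi i M j / n): the exponents M(M+1)/2 and
   M(M-1)/2 are integers, so the branch of the logarithm of a^(1/n^2) is
   irrelevant. Splitting the second sum into residue classes gives
   G = sqrt(n) A F for the DFT matrix A. As (A^2 F)_j = F_(-j), the vector v(k)
   is F + (-i)^k A F + (-i)^(2k) A^2 F + (-i)^(3k) A^3 F, and A^4 = I makes it
   an eigenvector for i^k. Since |ab| < 1, |g(M)| has Gaussian decay if a b is
   nonzero, and g is supported in {-1, 0, 1} otherwise. *)
Require Import Defs.
From mathcomp Require Import all_boot all_order all_algebra.
From mathcomp Require Import all_classical all_reals all_analysis.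
From mathcomp Require Import complex.
From mathcomp Require Import ring lra zify.

Import Order.TTheory GRing.Theory Num.Theory.
Import numFieldNormedType.Exports.

Local Open Scope ring_scope.
Local Open Scope complex_scope.

(** * The complex exponential and powers relative to a branch of the logarithm *)

Section Cexp.
Context {R : realType}.
Implicit Types (z w : R[i]) (L : R[i] -> R[i]).

Lemma cexpD z w : cexp (z + w) = cexp z * cexp w.
Proof.
case: z w => [u v] [u' v'] /=; rewrite expRD cosD sinD.
by apply/eqP; rewrite eq_complex /=; apply/andP; split; apply/eqP; ring.
Qed.

Lemma cexp0 : cexp 0 = 1 :> R[i].
Proof. by rewrite /= expR0 cos0 sin0 mul1r. Qed.

Lemma cexp_neq0 z : cexp z != 0.
Proof.
apply/eqP => z0; have := cexpD z (- z); rewrite z0 mul0r subrr cexp0.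
by move/eqP; rewrite oner_eq0.
Qed.

Lemma cexpMn z (m : nat) : cexp (m%:R * z) = cexp z ^+ m.
Proof.
elim: m => [|m IHm]; first by rewrite mul0r cexp0.
by rewrite exprS -IHm -cexpD -natr1 mulrDl mul1r addrC.
Qed.

Lemma cexpN z : cexp (- z) = (cexp z)^-1.
Proof.
apply: (mulfI (cexp_neq0 z)); rewrite -cexpD subrr cexp0 divff //.
exact: cexp_neq0.
Qed.

Lemma cexpMz z (m : int) : cexp (m%:~R * z) = cexp z ^ m.
Proof.
case: m => m; first exact: cexpMn.
by rewrite NegzE mulrNz mulNr cexpN -pmulrn cexpMn exprnN.
Qed.

Lemma norm_cexp z : `|cexp z| = (expR (complex.Re z))%:C.
Proof.
case: z => u v /=; rewrite normrM; have -> : `|cos v +i* sin v| = 1.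
  by rewrite normc_def /= cos2Dsin2 sqrtr1.
by rewrite mulr1 ger0_norm // ler0c expR_ge0.
Qed.

(** The real part is [cos (2 * (pi * t)) = 1 - 2 * sin (pi * t) ^+ 2], and the sine is positive
    strictly between 0 and [pi]. *)
Lemma cexp_neq1 (t : R) : 0 < t < 1 -> cexp ((2 * pi)%:C * 'i%C * t%:C) != 1.
Proof.
move=> /andP[t0 t1].
have -> : (2 * pi)%:C * 'i%C * t%:C = (0 +i* (2 * (pi * t)) : R[i]).
  by apply/eqP; rewrite eq_complex /=; apply/andP; split; apply/eqP; ring.
rewrite /= expR0 mul1r eq_complex /=; apply/negP => /andP[/eqP c1 _].
have := @sin_gt0_pi R (pi * t).
have p0 := pi_gt0 R.
rewrite mulr_gt0 //= gtr_pMr // t1 => /(_ isT) s0.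
have := cos2Dsin2 (pi * t); move: c1; rewrite mulr_natl mulr2n cosD.
nra.
Qed.

Lemma cexp2pi_int (m : int) : cexp ((2 * pi)%:C * 'i%C * m%:~R) = 1 :> R[i].
Proof.
rewrite mulrC cexpMz (_ : cexp _ = 1) ?exp1rz //.
have -> : (2 * pi)%:C * 'i%C = (0 +i* (pi *+ 2) : R[i]).
  by apply/eqP; rewrite eq_complex /=; apply/andP; split; apply/eqP; ring.
by rewrite /= expR0 mul1r cos2pi sin2pi.
Qed.

(** For natural [m] the choice of logarithm of [w] drops out: [cexp (m%:R * L w) = cexp (L w) ^+ m =
    w ^+ m]. At [z = 0], [s != 0] makes the inner power 0, and both sides only test whether [m] is
    0. *)
Lemma cpowM_nat L z s (m : nat) : log_branch L -> s != 0 ->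
  cpow L (cpow L z s) m%:R = cpow L z (s * m%:R).
Proof.
move=> hL s0; rewrite /cpow; case: (eqVneq z 0) => z0.
  by rewrite (negbTE s0) eqxx mulf_eq0 (negbTE s0).
rewrite (negbTE (cexp_neq0 _)) cexpMn hL ?cexp_neq0 // -cexpMn.
by congr cexp; ring.
Qed.

Lemma norm_log L z : log_branch L -> z != 0 ->
  `|z| = (expR (complex.Re (L z)))%:C.
Proof. by move=> hL /hL {1}<-; exact: norm_cexp. Qed.

End Cexp.

(** * Series in normed spaces and their partition into blocks *)

Lemma sum_blocks (V : zmodType) (f : nat -> V) (n N : nat) :
  \sum_(i < N * n) f i = \sum_(l < n) \sum_(k < N) f (k * n + l)%N.
Proof.
elim: N => [|N IHN].
  by rewrite mul0n big_ord0 big1 // => l _; rewrite big_ord0.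
under [RHS]eq_bigr do rewrite big_ord_recr /=.
rewrite big_split /= -IHN mulSnr.
by rewrite (big_split_ord _ _ (fun i : 'I_(N * n + n) => f i)).
Qed.

Section NormedSeries.
Context {K : numFieldType} {V : normedModType K}.
Implicit Types (f g : nat -> V) (s t : V).

Lemma cvg_seriesZ c f s : (series f @ \oo --> s)%classic ->
  (series (c *: f) @ \oo --> c *: s)%classic.
Proof. by move=> fs; rewrite seriesZ; exact: cvgZl_tmp. Qed.

Lemma series_recl f k : series f k.+1 = f 0 + series (fun i => f i.+1) k.
Proof. by rewrite /series /= !big_mkord big_ord_recl. Qed.

Lemma cvg_series_recl f s : (series (fun k => f k.+1) @ \oo --> s)%classic <->
  (series f @ \oo --> f 0 + s)%classic.
Proof.
have shifted (t : V) : (series f @ \oo --> t)%classic <->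
    ((fun k => f 0 + series (fun i => f i.+1) k) @ \oo --> t)%classic.
  rewrite -(cvg_shiftS (series f)).
  by under [X in (X @ _)%classic]eq_fun do rewrite series_recl.
rewrite shifted; split => [fs|]; first by apply: cvgD => //; exact: cvg_cst.
move=> fs; rewrite -(addKr (f 0) s) (_ : series _ =
  cst (- f 0) + (fun k => f 0 + series (fun i => f i.+1) k)).
  by apply: cvgD fs; exact: cvg_cst.
by apply/funext => k; rewrite [RHS]addKr.
Qed.

Lemma cvg_sum (I : Type) (r : seq I) (f : I -> nat -> V) (s : I -> V) :
  (forall i, f i @ \oo --> s i)%classic ->
  ((fun k => \sum_(i <- r) f i k) @ \oo --> \sum_(i <- r) s i)%classic.
Proof.
by move=> fs; apply: cvg_big => [|i _]; [exact: add_continuous|exact: fs].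
Qed.

(** Along the indices [k * n] the partial sums of [f] still tend to [s], and they also tend to the
    finite sum of the [t l]; limits are unique. *)
Lemma lim_series_blocks (n : nat) f s (g : 'I_n -> nat -> V) (t : 'I_n -> V) :
  (0 < n)%N -> (forall k, series f (k * n)%N = \sum_l series (g l) k) ->
  (series f @ \oo --> s)%classic ->
  (forall l, series (g l) @ \oo --> t l)%classic -> s = \sum_l t l.
Proof.
move=> n0 fg fs gt.
apply: (@cvg_unique _ (@norm_hausdorff _ V)
  ((series f \o muln^~ n) @ \oo)%classic).
  by apply: cvg_comp fs; exact: cvg_mulnr.
rewrite /= (_ : _ \o _ = fun k => \sum_l series (g l) k); first exact: cvg_sum.
by apply/funext => k; exact: fg.
Qed.

End NormedSeries.

(** * Convergence and rearrangement of sums over the integers *)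

Section BilateralSum.
Context {R : realType}.
Implicit Types (u v : int -> R[i]) (s t : R[i]).

Lemma cvg_complex (f : nat -> R[i]) (x y : R) :
  ((fun k => complex.Re (f k)) @ \oo --> x)%classic ->
  ((fun k => complex.Im (f k)) @ \oo --> y)%classic ->
  ((f : nat -> R[i]^o) @ \oo --> (x +i* y : R[i]^o))%classic.
Proof.
(* A positive [e] in [R[i]] is real, so half of its real part can be allotted to each component. *)
move=> fx fy; apply/cvgrPdist_lt => e; rewrite ltcE /= => /andP[/eqP e0 e1].
have e2 : 0 < complex.Re e / 2 by lra.
near=> k.
have hx : `|x - complex.Re (f k)| < complex.Re e / 2.
  by near: k; exact: cvgr_dist_lt.
have hy : `|y - complex.Im (f k)| < complex.Re e / 2.
  by near: k; exact: cvgr_dist_lt.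
rewrite ltcE /= e0 eqxx /=.
case: (f k) hx hy => p q /= hx hy.
apply: (@le_lt_trans _ _ (`|x - p| + `|y - q|)); last lra.
rewrite -[leRHS]ger0_norm ?addr_ge0 // -sqrtr_sqr ler_wsqrtr // [leRHS]sqrrD.
rewrite -!normrX !(ger0_norm (sqr_ge0 _)) addrAC lerDl.
by rewrite mulrn_wge0 // mulr_ge0.
Unshelve. all: by end_near.
Qed.

Lemma cvg_series_dominated (f : nat -> R[i]) (g : nat -> R) :
  (forall k, `|f k| <= (g k)%:C) -> cvgn (series g) ->
  cvgn (series (f : nat -> R[i]^o)).
Proof.
move=> fg cg.
have g0 k : 0 <= g k by have := le_trans (normr_ge0 _) (fg k); rewrite ler0c.
have bound (p : R[i] -> R) : (forall z, `|p z|%:C <= `|z|) ->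
    cvgn (series (p \o f)).
  move=> pz; apply: normed_cvg; apply: series_le_cvg cg => //= k.
  by rewrite -lecR; apply: le_trans (pz _) (fg k).
have /bound/cvg_ex[x fx] := @normc_ge_Re R.
(* The imaginary part reduces to the real one: multiplying by ['i%C] turns [Im z] into [- Re] and
   preserves the modulus. *)
have /bound/cvg_ex[y fy] : forall z : R[i], `|complex.Im z|%:C <= `|z|.
  by move=> z; have := normc_ge_Re (z * 'i%C); rewrite ReiNIm normrN normrM
    (normc_def 'i%C) /= expr0n expr1n add0r sqrtr1 mulr1.
apply/cvg_ex; exists (x +i* y); apply: cvg_complex.
- have -> // : (fun k => complex.Re (series f k)) = series (@complex.Re R \o f).
  by apply/funext => k; rewrite /series /=
    (raddf_sum (@complex.Re R : Rcomplex R -> R)).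
- have -> // : (fun k => complex.Im (series f k)) = series (@complex.Im R \o f).
  by apply/funext => k; rewrite /series /=
    (raddf_sum (@complex.Im R : Rcomplex R -> R)).
Qed.

(** [limn] has a value even for a divergent sequence, so [bilateral_sum] alone asserts no
    convergence; here both half-series are required to converge. *)
Definition has_bsum u s := exists s1 s2 : R[i]^o,
  [/\ (series (fun k : nat => u k%:Z : R[i]^o) @ \oo --> s1)%classic,
      (series (fun k : nat => u (- k.+1%:Z) : R[i]^o) @ \oo --> s2)%classic
    & s = s1 + s2].

Lemma has_bsum_unique u s : has_bsum u s -> bilateral_sum u = s.
Proof.
case=> s1 [s2 [h1 h2 ->]]; rewrite /bilateral_sum.
by rewrite (cvg_lim (@norm_hausdorff _ _) h1)
  (cvg_lim (@norm_hausdorff _ _) h2).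
Qed.

Lemma has_bsumZ c u s : has_bsum u s -> has_bsum (fun m => c * u m) (c * s).
Proof.
move=> [s1 [s2 [u1 u2 ->]]]; exists (c * s1), (c * s2).
split; last by rewrite mulrDr.
- exact: cvg_seriesZ u1.
- exact: cvg_seriesZ u2.
Qed.

Lemma has_bsum_shift u s : has_bsum u s -> has_bsum (fun m => u (m + 1)) s.
Proof.
(* The shift moves the term [u 0] from the nonnegative half to the negative half. *)
move=> [s1 [s2 [u1 u2 ->]]]; exists (s1 - u 0), (u 0 + s2).
pose f := fun k : nat => u k : R[i]^o.
pose g := fun k : nat => u (- k%:Z) : R[i]^o.
split; last by rewrite addrA subrK.
- rewrite (_ : (fun k : nat => _) = fun k : nat => f k.+1).
    have e : f 0 + (s1 - f 0) = s1 by rewrite addrC subrK.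
    by apply: (iffRL (cvg_series_recl f (s1 - f 0))); rewrite e; exact: u1.
  by apply/funext => k; congr u; lia.
- rewrite (_ : (fun k : nat => _) = g).
    by apply: (iffLR (cvg_series_recl g s2)); exact: u2.
  by apply/funext => k; congr u; lia.
Qed.

Lemma has_bsum_blocks (n : nat) u s (s_ : 'I_n -> R[i]) : (0 < n)%N ->
  has_bsum u s ->
  (forall l : 'I_n, has_bsum (fun m => u (m * n%:Z + l%:Z)) (s_ l)) ->
  s = \sum_l s_ l.
Proof.
move=> n0 [s1 [s2 [u1 u2 ->]]] /choice[a] /choice[b] ab.
have -> : s1 = \sum_l a l.
  apply: (lim_series_blocks n _ _
    (fun l k => u (k%:Z * n%:Z + l%:Z) : R[i]^o) _ n0 _ u1) => [k|l].
    rewrite /series /= big_mkord (sum_blocks _ (fun i : nat => u i)).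
    apply: eq_bigr => l _.
    by rewrite big_mkord; apply: eq_bigr => i _; congr u; lia.
  by have [h _ _] := ab l; exact: h.
have -> : s2 = \sum_l b l.
  apply: (lim_series_blocks n _ _
    (fun l k => u (- k.+1%:Z * n%:Z + l%:Z) : R[i]^o) _ n0 _ u2) => [k|l].
    rewrite /series /= big_mkord (sum_blocks _ (fun i => u (- i.+1%:Z))).
    (* On the negative half, -(i n + l + 1) = -(i + 1) n + (n - 1 - l): residues come in reverse
       order. *)
    rewrite (reindex_inj rev_ord_inj) /=; apply: eq_bigr => l _.
    rewrite big_mkord; apply: eq_bigr => i _.
    by congr u; have := ltn_ord l; nia.
  by have [_ h _] := ab l; exact: h.
by rewrite -big_split /=; apply: eq_bigr => l _; case: (ab l).
Qed.

(** Weaker than Gaussian decay, but sufficient for convergence and stable under restriction to a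
    residue class. *)
Definition geom_bounded u := exists C r : R,
  [/\ 0 <= C, 0 < r, r < 1 & forall m : int, `|u m| <= (C * r ^+ `|m|%N)%:C].

Lemma geom_has_bsum u : geom_bounded u -> has_bsum u (bilateral_sum u).
Proof.
move=> [C [r [C0 r0 r1 ur]]].
have cr : `|r| < 1 by rewrite gtr0_norm.
exists (limn (series (fun k : nat => u k%:Z : R[i]^o))).
exists (limn (series (fun k : nat => u (- k.+1%:Z) : R[i]^o))).
split => //.
- apply: (@cvg_series_dominated _ (geometric C r)) => [k|].
    exact: ur.
  exact: is_cvg_geometric_series.
- apply: (@cvg_series_dominated _ (geometric (C * r) r)) => [k|].
    by apply: le_trans (ur _) _; rewrite lecR /= -mulrA -exprS.
  exact: is_cvg_geometric_series.
Qed.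

Lemma geom_bounded_comp u (n : nat) (z : int) : (0 < n)%N ->
  geom_bounded u -> geom_bounded (fun m => u (m * n%:Z + z)).
Proof.
(* The constant comes from |m| <= |m n + z| + |z|, valid since n >= 1. *)
move=> n0 [C [r [C0 r0 r1 ur]]]; exists (C / r ^+ `|z|%N), r; split => //.
  by rewrite divr_ge0 // exprn_ge0 // ltW.
move=> m; apply: le_trans (ur _) _; rewrite lecR -mulrA ler_wpM2l //.
rewrite ler_pdivlMl ?exprn_gt0 // -exprD ler_wiXn2l ?ltW //.
nia.
Qed.

Lemma geom_boundedM u (e : int -> R[i]) : (forall m, `|e m| = 1) ->
  geom_bounded u -> geom_bounded (fun m => e m * u m).
Proof.
move=> e1 [C [r [C0 r0 r1 ur]]]; exists C, r; split => // m.
by rewrite normrM e1 mul1r.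
Qed.

End BilateralSum.

(** * Decay of the summand common to both kinds of theta series *)

Section GaussTerm.
Context {R : realType}.
Implicit Types (a b x : R[i]) (m z : int).

Lemma finite_geom_bounded (u : int -> R[i]) :
  (forall m, (1 < `|m|)%N -> u m = 0) -> geom_bounded u.
Proof.
move=> u0; pose N (w : R[i]) : R := complex.Re `|w|.
have NE w : `|w| = (N w)%:C by rewrite RRe_real // normr_real.
have N0 w : 0 <= N w by rewrite -ler0c -NE.
(* The factor 2 offsets the ratio 1/2 at [m = 1] and [m = -1]. *)
exists (2 * (N (u (-1)) + N (u 0) + N (u 1))), 2^-1.
have [n1 n0 p1] := And3 (N0 (u (-1))) (N0 (u 0)) (N0 (u 1)).
split; [by lra|by lra|by lra|move=> m].
case: (ltnP 1 `|m|%N) => [/u0 ->|m1].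
  by rewrite normr0 ler0c mulr_ge0 ?exprn_ge0 //; lra.
rewrite NE lecR.
have [->|[->|->]] : m = 0 \/ (m = 1 \/ m = -1) by lia.
- by rewrite absz0 expr0; lra.
- by rewrite /= expr1; lra.
- by rewrite /= expr1; lra.
Qed.

(** Completing the square in t = |m| bounds -c t^2 + (|d| + 1) t by (|d| + 1)^2 / (4c); the extra 1
    leaves the decay -t. *)
Lemma gaussian_exponent_le (c d : R) : 0 < c -> exists K, forall m,
  - c * m%:~R ^+ 2 + d * m%:~R <= K + `|m|%N%:R * (-1).
Proof.
move=> c0; exists ((`|d| + 1) ^+ 2 / (4 * c)) => m.
have -> : m%:~R ^+ 2 = `|m|%N%:R ^+ 2 :> R.
  by rewrite natr_absz intr_norm real_normK ?num_real.
have : d * m%:~R <= `|d| * `|m|%N%:R.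
  by rewrite natr_absz intr_norm -normrM ler_norm.
set t := `|m|%N%:R; set e := `|d| => dt.
have : 0 <= (2 * c * t - (e + 1)) ^+ 2 / (4 * c).
  by rewrite divr_ge0 ?sqr_ge0 //; lra.
have -> : (2 * c * t - (e + 1)) ^+ 2 / (4 * c) =
    c * t ^+ 2 - (e + 1) * t + (e + 1) ^+ 2 / (4 * c).
  by field; rewrite gt_eqF.
lra.
Qed.

Variables (La Lb : R[i] -> R[i]) (n : nat) (a b x : R[i]).

Definition gauss_term m : R[i] :=
  cpow La a ((m * (m + 1))%:~R / (2 * n%:R ^+ 2)) *
  cpow Lb b ((m * (m - 1))%:~R / (2 * n%:R ^+ 2)) *
  cexp ((2 * pi)%:C * 'i%C * (m%:~R * x / n%:R)).

Lemma gauss_term_geom_bounded : log_branch La -> log_branch Lb ->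
  (0 < n)%N -> `|a * b| < 1 -> geom_bounded gauss_term.
Proof.
move=> hLa hLb n0 hab.
have n0C : (n%:R : R[i]) != 0 by rewrite pnatr_eq0 -lt0n.
have D0 : (2 * n%:R ^+ 2 : R[i])^-1 != 0.
  by rewrite invr_eq0 mulf_neq0 ?expf_neq0 // pnatr_eq0.
(* A power of 0 is nonzero only for exponent 0, so [a = 0] leaves [m] in {-1, 0}, and [b = 0] leaves
   [m] in {0, 1}. *)
have [a0|a0] := eqVneq a 0.
  apply: finite_geom_bounded => m m1; rewrite /gauss_term /cpow a0 eqxx.
  rewrite mulf_eq0 (negbTE D0) orbF intr_eq0 (_ : _ == 0 = false) ?mul0r //.
  by apply/negP => /eqP; nia.
have [b0|b0] := eqVneq b 0.
  apply: finite_geom_bounded => m m1; rewrite /gauss_term {2}/cpow b0 eqxx.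
  rewrite mulf_eq0 (negbTE D0) orbF intr_eq0 (_ : _ == 0 = false).
    by rewrite mulr0 mul0r.
  by apply/negP => /eqP; nia.
set A := complex.Re (La a); set B := complex.Re (Lb b).
(* This is the logarithm of |ab| < 1; it makes the quadratic coefficient of the exponent
   negative. *)
have AB : A + B < 0.
  move: hab; rewrite normrM (norm_log _ _ hLa a0) (norm_log _ _ hLb b0).
  by rewrite -rmorphM -expRD -[1]/(1%:C) ltcR -expR0 ltr_expR.
pose D : R := 2 * n%:R ^+ 2.
have Dgt0 : 0 < D by rewrite mulr_gt0 ?exprn_gt0 // ltr0n.
have c0 : 0 < - (A + B) / D by rewrite divr_gt0 // oppr_gt0.
(* The coefficient of [m] in the real part of the exponent: A m(m+1) and B m(m-1) contribute A - B,
   and the factor 2 pi i m x / n contributes through [Im x]. *)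
pose d := (A - B) / D - 2 * pi * complex.Im x / n%:R.
have [K hK] := gaussian_exponent_le _ d c0.
exists (expR K), (expR (-1)); split; rewrite ?expR_ge0 ?expR_gt0 //.
move=> m; rewrite -expRM_natl -expRD.
have -> : gauss_term m = cexp (((m * (m + 1))%:~R / D)%:C * La a +
    ((m * (m - 1))%:~R / D)%:C * Lb b +
    ((2 * pi * m%:~R / n%:R)%:C * ('i%C * x))).
  rewrite /gauss_term /cpow (negbTE a0) (negbTE b0) -!cexpD; congr cexp.
  rewrite !(rmorphM, rmorphXn, rmorph_nat, rmorph_int, fmorphV) /=.
  by ring.
rewrite norm_cexp lecR ler_expR; apply: le_trans (hK m).
rewrite /d /A /B; case: (La a) (Lb b) x => [p q] [p' q'] [y y'] /=.
rewrite !intrM !(intrD _ m) /= le_eqVlt; apply/orP; left; apply/eqP; field.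
by rewrite !gt_eqF // ltr0n.
Qed.

(** With M = m n + z the variable t of [theta_term] is M / n, so t (t + 1/n) / 2 = M (M + 1) / (2
    n^2), and likewise with minus signs. *)
Lemma theta_term_block z m : (0 < n)%N ->
  theta_term La Lb (z%:~R / n%:R) 0 n%:R a b x m = gauss_term (m * n%:Z + z).
Proof.
move=> n0; have n0C : (n%:R : R[i]) != 0 by rewrite pnatr_eq0 -lt0n.
rewrite /theta_term /gauss_term addr0; congr (cpow _ _ _ * cpow _ _ _ * cexp _);
  by rewrite !(intrM, intrD, mulrNz) -?[n%:~R]/(n%:R); field.
Qed.

End GaussTerm.

(** * Roots of unity and the finite Fourier transform of periodic functions *)

Section RootOfUnity.
Context {R : realType} (n : nat) (n_gt0 : (0 < n)%N).
Implicit Types (q z j : int).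

Definition unity_root q : R[i] :=
  cexp ((2 * pi)%:C * 'i%C * (q%:~R / n%:R)).

Let n_neq0 : (n%:R : R[i]) != 0. Proof. by rewrite pnatr_eq0 -lt0n. Qed.

Lemma unity_rootD p q : unity_root (p + q) = unity_root p * unity_root q.
Proof. by rewrite /unity_root -cexpD -mulrDr -mulrDl intrD. Qed.

Lemma unity_rootM p q : unity_root (p * q) = unity_root q ^ p.
Proof. by rewrite /unity_root -cexpMz intrM; congr cexp; ring. Qed.

Lemma unity_root_mul q : unity_root (q * n%:Z) = 1.
Proof. by rewrite /unity_root intrM mulfK // cexp2pi_int. Qed.

Lemma norm_unity_root q : `|unity_root q| = 1.
Proof.
rewrite norm_cexp (_ : complex.Re _ = 0) ?expR0 //.
rewrite (_ : q%:~R / n%:R = (q%:~R / n%:R)%:C) /=; first by ring.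
by rewrite !(rmorphM, rmorph_nat, rmorph_int, fmorphV).
Qed.

(** Modulo [n], a nonmultiple leaves a remainder r with 0 < r / n < 1, where [cexp_neq1] applies. *)
Lemma unity_root_eq1 q : (unity_root q == 1) = (n %| q)%Z.
Proof.
apply/idP/idP => [|/dvdzP[p ->]]; last by rewrite unity_root_mul.
apply: contraTT => nq.
rewrite (divz_eq q n%:Z) unity_rootD unity_root_mul mul1r.
have r0 : 0 < (q %% n)%Z by rewrite lt_neqAle eq_sym modz_ge0 ?andbT; lia.
have rn : (q %% n)%Z < n%:Z by rewrite ltz_pmod; lia.
rewrite /unity_root (_ : _ / _ = ((q %% n)%Z%:~R / n%:R)%:C).
  apply: cexp_neq1; rewrite divr_gt0 ?ltr0z ?ltr0n //=.
  by rewrite ltr_pdivrMr ?ltr0n // mul1r -[n%:R]/(n%:Z%:~R) ltr_int.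
by rewrite !(rmorphM, rmorph_nat, rmorph_int, fmorphV).
Qed.

(** Orthogonality of characters, from the geometric sum identity w^n - 1 = (w - 1) (1 + ... +
    w^(n-1)). *)
Lemma sum_unity_root q :
  \sum_(l < n) unity_root (l%:Z * q) = if (n %| q)%Z then n%:R else 0.
Proof.
under eq_bigr do rewrite unity_rootM.
case: ifPn => [|nq].
  rewrite -unity_root_eq1 => /eqP ->.
  under eq_bigr do rewrite exp1rz.
  by rewrite sumr_const card_ord.
have := subrX1 (unity_root q) n; rewrite exprnP -unity_rootM mulrC.
rewrite unity_root_mul subrr => /esym/eqP.
by rewrite mulf_eq0 subr_eq0 unity_root_eq1 (negbTE nq) => /eqP.
Qed.

(** Functions on Z_n are encoded as periodic functions on Z, so that the index [- j] makes sense
    without reduction. *)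
Definition periodic_int (F : int -> R[i]) := forall z, F (z + n%:Z) = F z.

Lemma unity_root_periodic j : periodic_int (fun l => unity_root (j * l)).
Proof. by move=> z; rewrite mulrDr unity_rootD unity_root_mul mulr1. Qed.

Lemma periodicM F H : periodic_int F -> periodic_int H ->
  periodic_int (fun z => F z * H z).
Proof. by move=> pF pH z; rewrite pF pH. Qed.

Lemma periodic_modz F z : periodic_int F -> F (z %% n)%Z = F z.
Proof.
move=> pF; rewrite {2}(divz_eq z n%:Z); move: (z %/ n)%Z (z %% n)%Z => q r.
elim/int_rect: q => [|q IHq|q IHq]; first by rewrite mul0r add0r.
- by rewrite IHq -pF; congr F; lia.
- by rewrite IHq -[RHS]pF; congr F; lia.
Qed.

(** Reversing the order and adding the period turns the left side into the sum of F(l + 1); its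
    difference with the right side telescopes to F(n) - F(0) = 0. *)
Lemma periodic_sumN F : periodic_int F ->
  \sum_(l < n) F (- l%:Z) = \sum_(l < n) F l%:Z.
Proof.
move=> pF; rewrite (reindex_inj rev_ord_inj) /=.
have -> : \sum_(l < n) F (- (n - l.+1)%N%:Z) = \sum_(l < n) F (l.+1%:Z).
  by apply: eq_bigr => l _; rewrite -pF; congr F; have := ltn_ord l; lia.
apply/eqP; rewrite -subr_eq0 -sumrB.
rewrite -(big_mkord xpredT (fun l => F l.+1%:Z - F l%:Z)).
by rewrite (telescope_sumr (fun l : nat => F l%:Z)) // subr_eq0 -(pF 0) add0r.
Qed.

(** The DFT without its factor 1 / sqrt n, extended to every integer frequency. *)
Definition dft_sum (F : int -> R[i]) z : R[i] :=
  \sum_(l < n) unity_root (z * l%:Z) * F l%:Z.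

Lemma dft_sumD F H j :
  dft_sum (fun z => F z + H z) j = dft_sum F j + dft_sum H j.
Proof. by rewrite -big_split; apply: eq_bigr => l _; rewrite mulrDr. Qed.

Lemma dft_sumZ c F j : dft_sum (fun z => c * F z) j = c * dft_sum F j.
Proof. by rewrite mulr_sumr; apply: eq_bigr => l _; rewrite mulrCA. Qed.

Lemma dft_sum_periodic F : periodic_int (dft_sum F).
Proof.
move=> z; apply: eq_bigr => l _; congr (_ * _).
by rewrite mulrC unity_root_periodic mulrC.
Qed.

Lemma dft_sum_opp F j : periodic_int F ->
  dft_sum (fun l => F (- l)) j = dft_sum F (- j).
Proof.
move=> pF; rewrite /dft_sum.
rewrite -(periodic_sumN (fun l => unity_root (- j * l) * F l)).
  by apply: eq_bigr => l _; rewrite mulrNN.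
exact: periodicM (unity_root_periodic _) pF.
Qed.

(** The square of the DFT is the reflection of Z_n: after exchanging the sums, orthogonality keeps
    only the index [p] congruent to [- j] modulo [n]. *)
Lemma dft_sumK F j : periodic_int F -> dft_sum (dft_sum F) j = n%:R * F (- j).
Proof.
move=> pF; rewrite /dft_sum.
under eq_bigr do rewrite mulr_sumr.
rewrite exchange_big /=.
have -> : \sum_(p < n) \sum_(l < n)
    unity_root (j * l%:Z) * (unity_root (l%:Z * p%:Z) * F p%:Z) =
  \sum_(p < n) (if (n %| j + p%:Z)%Z then n%:R else 0) * F p%:Z.
  apply: eq_bigr => p _; rewrite -sum_unity_root mulr_suml.
  apply: eq_bigr => l _; rewrite mulrA -unity_rootD; congr (unity_root _ * _).
  by ring.
have r0 : 0 <= (- j %% n)%Z by rewrite modz_ge0; lia.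
have rn : (`|- j %% n|%Z < n)%N by have := @ltz_pmod (- j) n%:Z; lia.
rewrite (bigD1 (Ordinal rn)) //= big1 ?addr0 => [|p pj].
  rewrite gez0_abs // periodic_modz // ifT //.
  by apply/dvdzP; exists (- (- j %/ n)%Z); have := divz_eq (- j) n; lia.
rewrite ifF ?mul0r //; apply: contraNF pj => /dvdzP[q jq].
apply/eqP/val_inj => /=.
rewrite (_ : - j = - q * n%:Z + p%:Z); last by lia.
by rewrite modzMDl modz_small //=; have := ltn_ord p; lia.
Qed.

End RootOfUnity.

(** * The two theta families as a periodic function and its transform *)

Lemma mulz_succ_half (m : int) : exists N : nat, m * (m + 1) = N%:Z * 2.
Proof.
have half (t : nat) : exists N : nat, t%:Z * (t%:Z + 1) = N%:Z * 2.
  elim: t => [|t [N tN]]; first by exists 0%N.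
  by exists (N + t.+1)%N; lia.
case: m => t; first exact: half.
by have [N tN] := half t; exists N; lia.
Qed.

Section ThetaFrequency.
Context {R : realType} (La Lb : R[i] -> R[i]).
Hypotheses (hLa : log_branch La) (hLb : log_branch Lb).
Variables (n : nat) (a b x : R[i]).
Hypothesis n_gt0 : (0 < n)%N.

Let n_neq0 : (n%:R : R[i]) != 0. Proof. by rewrite pnatr_eq0 -lt0n. Qed.

Lemma theta_term_frequency (z m : int) :
  theta_term La Lb 0 (z%:~R / n%:R) 1 (cpow La a (n%:R ^+ 2)^-1)
    (cpow Lb b (n%:R ^+ 2)^-1) (x / n%:R) m =
  unity_root n (z * m) * gauss_term La Lb n a b x m.
Proof.
have s0 : (n%:R ^+ 2 : R[i])^-1 != 0 by rewrite invr_eq0 expf_neq0.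
have [N mN] := mulz_succ_half m; have [M mM] := mulz_succ_half (m - 1).
rewrite subrK in mM.
have twice (e : int) (K : nat) : e = K%:Z * 2 -> e%:~R / 2 = K%:R :> R[i].
  by move=> ->; rewrite intrM mulfK // pnatr_eq0.
rewrite /theta_term addr0 invr1.
rewrite (_ : m%:~R * (m%:~R + 1) / 2 = N%:R); last first.
  by rewrite -(twice _ _ mN) intrM intrD.
rewrite (_ : m%:~R * (m%:~R - 1) / 2 = M%:R); last first.
  by rewrite -(twice _ _ mM) intrM intrB [X in X / _]mulrC.
rewrite !cpowM_nat // /gauss_term mN [m * (m - 1)]mulrC mM.
rewrite /unity_root mulrCA -cexpD !intrM.
congr (cpow _ _ _ * cpow _ _ _ * cexp _); field; exact: n_neq0.
Qed.

Hypothesis ab_lt1 : `|a * b| < 1.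

Definition theta_block (z : int) : R[i] :=
  theta La Lb (z%:~R / n%:R) 0 n%:R a b x.

Definition theta_frequency (z : int) : R[i] :=
  theta La Lb 0 (z%:~R / n%:R) 1 (cpow La a (n%:R ^+ 2)^-1)
    (cpow Lb b (n%:R ^+ 2)^-1) (x / n%:R).

Let g_bounded := gauss_term_geom_bounded La Lb n a b x hLa hLb n_gt0 ab_lt1.

Lemma theta_block_has_bsum z :
  has_bsum (fun m => gauss_term La Lb n a b x (m * n%:Z + z)) (theta_block z).
Proof.
rewrite /theta_block /theta.
rewrite (_ : theta_term _ _ _ _ _ _ _ _ =
  fun m => gauss_term La Lb n a b x (m * n%:Z + z)).
  by apply: geom_has_bsum; exact: geom_bounded_comp g_bounded.
by apply/funext => m; exact: theta_term_block.
Qed.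

Lemma theta_block_periodic : periodic_int n theta_block.
Proof.
move=> z; rewrite -(has_bsum_unique _ _ (theta_block_has_bsum (z + n%:Z))).
rewrite -(has_bsum_unique _ _ (has_bsum_shift _ _ (theta_block_has_bsum z))).
by congr bilateral_sum; apply/funext => m; congr gauss_term; lia.
Qed.

Lemma theta_frequencyE z : theta_frequency z = dft_sum n theta_block z.
Proof.
apply: (has_bsum_blocks n
  (fun m => unity_root n (z * m) * gauss_term La Lb n a b x m)) => // [|l].
  rewrite /theta_frequency /theta (_ : theta_term _ _ _ _ _ _ _ _ =
    fun m => unity_root n (z * m) * gauss_term La Lb n a b x m).
    apply: geom_has_bsum; apply: geom_boundedM => // m.
    exact: norm_unity_root.
  by apply/funext => m; exact: theta_term_frequency.
rewrite (_ : (fun m => _) = fun m => unity_root n (z * l%:Z) *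
  gauss_term La Lb n a b x (m * n%:Z + l%:Z)).
  exact: has_bsumZ (theta_block_has_bsum _).
apply/funext => m; congr (_ * _).
by rewrite mulrDr mulrA unity_rootD unity_root_mul // mul1r.
Qed.

End ThetaFrequency.

Lemma exprz_sqrtN1 (K : fieldType) (i : K) (k : int) : i * i = -1 ->
  [/\ i ^ k * (-1) ^ k = (- i) ^ k, i ^ k * (- i) ^ k = 1,
      i ^ k * (- i) ^ (3 * k) = (-1) ^ k & (- i) ^ (3 * k) = i ^ k].
Proof.
move=> ii.
have e3 : (- i) ^ (3 * k) = i ^ k.
  rewrite -exprz_exp; congr (_ ^ k).
  by rewrite -exprnP !exprS expr0 mulr1 mulrNN ii mulrN1 opprK.
by rewrite e3 -!expfzMl mulrN1 mulrN ii opprK exp1rz.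
Qed.

Lemma eigen_combination (K : comNzRingType) (s c e d d3 N f fN g gN : K) :
  s * s * N = 1 -> c * e = d -> c * d = 1 -> c * d3 = e -> d3 = c ->
  s * (g + e * gN + s * (d * (N * fN) + d3 * (N * f))) =
  c * (f + e * fN + s * (d * g + d3 * gN)).
Proof.
move=> sN ce cd cd3 d3c.
transitivity (c * f + (c * e) * fN + s * ((c * d) * g + (c * d3) * gN));
  last by ring.
rewrite ce cd cd3 d3c mul1r.
transitivity (s * (g + e * gN) + (s * s * N) * (d * fN + c * f)); first by ring.
by rewrite sN; ring.
Qed.

Theorem theorem2 (R : realType) (La Lb : R[i] -> R[i])
    (hLa : log_branch La) (hLb : log_branch Lb)
    (n : nat) (hn : (0 < n)%N) (a b : R[i]) (hab : `|a * b| < 1)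
    (x : R[i]) (k : int) :
  dft R n *m theta_vec La Lb n a b x k = 'i%C ^ k *: theta_vec La Lb n a b x k.
Proof.
have n0 : (n%:R : R[i]) != 0 by rewrite pnatr_eq0 -lt0n.
pose F := theta_block La Lb n a b x; pose G := dft_sum n F.
have pF : periodic_int n F by exact: theta_block_periodic.
have pG : periodic_int n G by exact: dft_sum_periodic.
pose s : R[i] := (Num.sqrt n%:R)%:C^-1.
have ss : s * s * n%:R = 1.
  by rewrite -invfM -rmorphM -expr2 sqr_sqrtr ?ler0n // rmorph_nat mulVf.
have vE (l : 'I_n) : theta_vec La Lb n a b x k l 0 =
    F l + (-1) ^ k * F (- l%:Z) +
    s * ((- 'i%C) ^ k * G l + (- 'i%C) ^ (3 * k) * G (- l%:Z)).
  rewrite mxE /G /F -!theta_frequencyE // /theta_block /theta_frequency.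
  by rewrite intrN mulNr.
(* With its body visible, [F] lets [dft_sumD] split the two limits inside
   [bilateral_sum]. *)
clearbody F; apply/matrixP => j c; rewrite (ord1 c) [LHS]mxE [RHS]mxE.
have -> : \sum_l dft R n j l * theta_vec La Lb n a b x k l 0 =
    s * dft_sum n (fun z => F z + (-1) ^ k * F (- z) +
      s * ((- 'i%C) ^ k * G z + (- 'i%C) ^ (3 * k) * G (- z))) j.
  rewrite /dft_sum mulr_sumr; apply: eq_bigr => l _.
  rewrite vE mxE -/s mulrA; congr (_ * _ * _).
  by rewrite /unity_root intrM !mulrA.
rewrite !(dft_sumD, dft_sumZ).
rewrite !dft_sum_opp // /G !dft_sumK // opprK vE -/G.
have [i1 i2 i3 i4] := exprz_sqrtN1 _ _ k (sqr_i R).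
exact: (eigen_combination _ _ _ _ _ _ _ _ _ _ _ ss i1 i2 i3 i4).
Qed.
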